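(* Let $\omega(n)$ be a function with $\omega(n)\to\infty$ as $n\to\infty$. Then, for all sufficiently large $n$, $$\mathbf{RT}\left(n,K_5,\frac{\sqrt{n\log n}}{\omega(n)}\right)\le \frac{n^2}{\sqrt[4]{\omega(n)}},$$ and in particular $\mathbf{RT}\left(n,K_5,\frac{\sqrt{n\log n}}{\omega(n)}\right)=o(n^2)$.
   Context: All graphs are simple and logarithms are base $2$. For a graph $H$ and a function $f$, $\mathbf{RT}(n,H,f(n))$ denotes the maximum number of edges of an $H$-free graph on $n$ vertices with independence number less than $f(n)$ (taken to be $0$ if no such graph exists). $K_5$ is the complete graph on $5$ vertices. The function $\omega$ is thought of as an arbitrary function tending to infinity slowly. *)

(* Defs.v *)
From HB Require Import structures.
From mathcomp Require Import all_boot all_order all_algebra.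
From mathcomp Require Import all_classical all_reals all_analysis.

Set Implicit Arguments.
Unset Strict Implicit.
Unset Printing Implicit Defensive.

Import Order.TTheory GRing.Theory Num.Theory.

Local Open Scope ring_scope.

Record sgraph (V : finType) := SGraph {
  edges :> {set {set V}};
  edges_card2 : edges \subset [set e : {set V} | #|e| == 2%N] }.

HB.instance Definition _ (V : finType) := [isSub for @edges V].
HB.instance Definition _ (V : finType) := [Finite of sgraph V by <:].

Definition adj (V : finType) (G : sgraph V) (x y : V) : bool :=
  [set x; y] \in edges G.

Definition complete_graph (V : finType) : sgraph V :=
  SGraph (subxx [set e : {set V} | #|e| == 2%N]).

(* The copy of H in G need not be induced. *)
Definition contains_copy (W V : finType) (H : sgraph W) (G : sgraph V) : bool :=
  [exists f : {ffun W -> V}, injectiveb f &&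
    [forall x, forall y, adj H x y ==> adj G (f x) (f y)]].

Definition free_of (W V : finType) (H : sgraph W) (G : sgraph V) : bool :=
  ~~ contains_copy H G.

Definition independent (V : finType) (G : sgraph V) (S : {set V}) : bool :=
  [forall x in S, forall y in S, ~~ adj G x y].

Definition independence_number (V : finType) (G : sgraph V) : nat :=
  \max_(S : {set V} | independent G S) #|S|.

(* The maximum over an empty family is 0. *)
Definition RT (R : realType) (W : finType) (n : nat) (H : sgraph W) (t : R)
    : nat :=
  \max_(G : sgraph 'I_n | free_of H G && ((independence_number G)%:R < t))
    #|edges G|.

Definition log2 (R : realType) (x : R) : R := ln x / ln 2.

(* Main.v *)
(* Put [y = omega^(1/4)] and let [a] be the independence number of a K_5-free
   graph on [n] vertices with more than [n^2 / y] edges. Dependent random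
   choice produces a set [U] of more than [a] vertices in which any two have at
   least [n / omega] common neighbours. As [#|U| > a], [U] contains an edge, and
   the common neighbourhood [M] of its ends is triangle-free. By the theorem of
   Ajtai, Komlos and Szemeredi (with Alon's proof through a uniformly random
   independent set), [#|M| log a <= 8 a^2]. Since [log n = O(log a)] by the
   elementary bound [n <= 4 a^4], the assumption [a < sqrt (n log n) / omega]
   forces [omega] to be bounded. *)
Require Import Defs.
From mathcomp Require Import all_boot all_order all_algebra.
From mathcomp Require Import all_classical all_reals all_analysis.
From mathcomp Require Import fintype finset zify ring lra.

Set Implicit Arguments.
Unset Strict Implicit.
Unset Printing Implicit Defensive.

Import Order.TTheory GRing.Theory Num.Theory.

Local Open Scope nat_scope.

(** * Elementary counting and logarithm inequalities *)

Lemma sum_card_powerset (V : finType) (X : {set V}) :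
  2 * \sum_(Y in powerset X) #|Y| = #|X| * 2 ^ #|X|.
Proof.
(* Complementation in [X] permutes its subsets, and a subset together with its complement has [#|X|]
   elements. *)
have compl : \sum_(Y in powerset X) #|Y| = \sum_(Y in powerset X) #|X :\: Y|.
  rewrite (reindex_onto (fun Y => X :\: Y) (fun Y => X :\: Y)) /=; last first.
    by move=> Y; rewrite powersetE => YX; rewrite setDDr setDv set0U; apply/setIidPr.
  apply: eq_bigl => Y; rewrite !powersetE subsetDl setDDr setDv set0U /=.
  by apply/eqP/idP => [/setIidPr|/setIidPr].
rewrite mul2n -addnn {2}compl -big_split /= -card_powerset mulnC -sum_nat_const.
apply: eq_bigr => Y; rewrite powersetE => YX.
by rewrite -(cardsID Y X); congr (_ + _); rewrite (setIidPr YX).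
Qed.

(** The right side is four times the weight of a fibre: one set containing the vertex, weighted [a],
    and [2 ^ x] sets of average trace [x / 2]. If [L <= 2 * x] the second part dominates; otherwise
    [2 ^ x] is at most the square root of [a]. *)
Lemma log_le_fibre_average (a L x : nat) :
  2 ^ L <= a -> L * (1 + 2 ^ x) <= 4 * a + 2 * (x * 2 ^ x).
Proof.
move=> La.
have L_lt : L < 2 ^ L by exact: ltn_expl.
have [Lx|xL] := leqP L (2 * x).
  have : L * 2 ^ x <= (2 * x) * 2 ^ x by rewrite leq_mul2r Lx orbT.
  lia.
set P := 2 ^ L./2.
have PP : P * P <= 2 ^ L.
  by rewrite -expnD leq_exp2l // addnn; rewrite -[X in _ <= X]odd_double_half leq_addl.
have kP : L./2 < P by exact: ltn_expl.
have xP : 2 ^ x <= P by rewrite leq_exp2l //; lia.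
have L2P : L <= 2 * P by lia.
have : L * 2 ^ x <= (2 * P) * P by exact: leq_mul.
lia.
Qed.

(** The exponent 10 comes from [4 * a ^ 4 <= 2 ^ (4 * L + 6)], where [L] is the truncated logarithm
    of [a] and is at least 1. *)
Lemma le_exp_trunc_log (n a : nat) : 5 <= n -> n <= 4 * a ^ 4 ->
  1 < a /\ n <= 2 ^ (10 * trunc_log 2 a).
Proof.
move=> n5 na.
have a2 : 1 < a by case: a na => [|[|a]] //; move/(leq_trans n5).
have L1 : 0 < trunc_log 2 a by rewrite trunc_log_gt0.
split=> //; apply: leq_trans na _.
apply: (@leq_trans (2 ^ 2 * (2 ^ (trunc_log 2 a).+1) ^ 4)).
  by rewrite leq_mul2l /= leq_exp2r // ltnW // trunc_log_ltn.
by rewrite -expnM -expnD leq_exp2l //; lia.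
Qed.

(** * Cliques and independent sets of a relation *)

Section Relation.
Variables (V : finType) (e : rel V).

(** For [e := adj G] this is convertible to [independent G]. *)
Definition indep (S : {set V}) : bool :=
  [forall x in S, forall y in S, ~~ e x y].

Definition clique (S : {set V}) : bool :=
  [forall x in S, forall y in S, (x != y) ==> e x y].

Definition nbhd (v : V) : {set V} := [set u | e v u].

Lemma indepP (S : {set V}) :
  reflect {in S &, forall x y, ~~ e x y} (indep S).
Proof.
apply: (iffP forall_inP) => [h x y xS yS|h x xS].
  by have /forall_inP := h _ xS; apply.
by apply/forall_inP => y yS; apply: h.
Qed.

Lemma cliqueP (S : {set V}) :
  reflect {in S &, forall x y, x != y -> e x y} (clique S).
Proof.
apply: (iffP forall_inP) => [h x y xS yS|h x xS].
  by have /forall_inP /(_ _ yS) /implyP := h _ xS; apply.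
by apply/forall_inP => y yS; apply/implyP; apply: h.
Qed.

Lemma indepS (S T : {set V}) : S \subset T -> indep T -> indep S.
Proof. by move=> /subsetP ST /indepP h; apply/indepP => x y /ST xT /ST; apply: h. Qed.

Hypotheses (e_sym : symmetric e) (e_irr : irreflexive e).

Lemma clique1U (v : V) (S : {set V}) :
  S \subset nbhd v -> clique S -> clique (v |: S).
Proof.
move=> /subsetP Sv /cliqueP cS; apply/cliqueP => x y.
rewrite !in_setU1 => /orP[/eqP->|xS] /orP[/eqP->|yS]; last exact: cS.
- by rewrite eqxx.
- by move/Sv: yS; rewrite inE.
- by move/Sv: xS; rewrite inE e_sym.
Qed.

Lemma nbhd_notin (v : V) (S : {set V}) : S \subset nbhd v -> v \notin S.
Proof. by move=> /subsetP Sv; apply/negP => /Sv; rewrite inE e_irr. Qed.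

(* A maximal independent subset dominates [U], and cliques inside a
   neighbourhood are smaller by one vertex. *)
Lemma card_clique_free (r a : nat) (U : {set V}) : 0 < a ->
  (forall S : {set V}, S \subset U -> clique S -> #|S| != r.+1) ->
  (forall S : {set V}, S \subset U -> indep S -> #|S| <= a) ->
  #|U| <= r * a ^ r.
Proof.
move=> a0; elim: r U => [|r IH] U hc hi.
  rewrite leqn0 cards_eq0; apply/eqP/setP => x; rewrite inE; apply/negP => xU.
  have := hc [set x]; rewrite sub1set xU cards1 eqxx => /(_ isT).
  by case: cliqueP => [_ /(_ isT)|[]] // ? ? /set1P-> /set1P->; rewrite eqxx.
have P0 : (set0 \subset U) && indep set0.
  by rewrite sub0set; apply/indepP => x; rewrite inE.
have [I /maxsetP [/andP[IU iI] Imax] _] :=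
  @maxset_exists _ (fun S : {set V} => (S \subset U) && indep S) _ P0.
have cover : U \subset I :|: \bigcup_(v in I) (U :&: nbhd v).
  apply/subsetP => x xU; rewrite inE; case: (boolP (x \in I)) => //= xI.
  apply/bigcupP; case: (boolP [exists v in I, e v x]) => [/exists_inP[v vI vx]|].
    by exists v => //; rewrite !inE xU.
  move/exists_inPn => h; case/negP: xI.
  rewrite -(Imax (x |: I)) ?setU11 ?subsetUr // subUset sub1set xU IU /=.
  apply/indepP => u w; rewrite !in_setU1 => /orP[/eqP->|uI] /orP[/eqP->|wI].
  - by rewrite e_irr.
  - by rewrite e_sym h.
  - exact: h.
  - by move/indepP: iI; apply.
have Ia : #|I| <= a by exact: hi.
have step v : v \in I -> #|U :&: nbhd v| <= r * a ^ r.
  move=> vI; apply: IH => S SU; last by apply: hi; apply: subset_trans SU (subsetIl _ _).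
  move=> cS; have Sv : S \subset nbhd v by apply: subset_trans SU (subsetIr _ _).
  have := hc (v |: S); rewrite cardsU1 nbhd_notin // add1n eqSS; apply.
    by rewrite subUset sub1set (subsetP IU) // (subset_trans SU) // subsetIl.
  exact: clique1U.
have : #|U| <= a + a * (r * a ^ r).
  apply: leq_trans (subset_leq_card cover) _.
  apply: leq_trans (leq_card_setU _ _) _; apply: leq_add => //.
  apply: (@leq_trans (\sum_(v in I) #|U :&: nbhd v|)).
    elim/big_rec2: _ => [|v A B _ h]; first by rewrite cards0.
    by apply: leq_trans (leq_card_setU _ _) _; rewrite leq_add2l.
  apply: (@leq_trans (\sum_(v in I) r * a ^ r)); first exact: leq_sum.
  by rewrite sum_nat_const leq_mul2r Ia orbT.
move=> h; apply: leq_trans h _; rewrite expnS mulSn mulnCA leq_add2r.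
by rewrite leq_pmulr // expn_gt0 a0.
Qed.

(** * Random independent sets in triangle-free graphs *)

Section TriangleFree.
Variables (M : {set V}) (a L : nat).
Hypothesis tri : forall S : {set V}, S \subset M -> clique S -> #|S| != 3.
Hypothesis alpha_le : forall S : {set V}, S \subset M -> indep S -> #|S| <= a.
Hypothesis La : 2 ^ L <= a.

Let I := [set W : {set V} | (W \subset M) && indep W].
Let N v := M :&: nbhd v.

Lemma indep_nbhd (v : V) : v \in M -> indep (N v).
Proof.
move=> vM; apply/indepP => x y; rewrite !inE => /andP[xM vx] /andP[yM vy].
apply/negP => xy.
have := tri (S := v |: (x |: [set y])).
rewrite !subUset !sub1set vM xM yM => /(_ isT).
have nvx : v != x by apply: contraTneq vx => ->; rewrite e_irr.
have nvy : v != y by apply: contraTneq vy => ->; rewrite e_irr.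
have nxy : x != y by apply: contraTneq xy => ->; rewrite e_irr.
rewrite !cardsU1 cards1 !inE negb_or nvx nvy nxy /= => H.
suff /H : clique (v |: (x |: [set y])) by [].
apply: clique1U; first by rewrite subUset !sub1set !inE vx vy.
apply: clique1U; first by rewrite sub1set inE.
by apply/cliqueP => ? ? /set1P-> /set1P->; rewrite eqxx.
Qed.

(* If [W] equals [T] outside the closed neighbourhood of [v], either it contains
   [v] and no vertex of [N v], or it meets [N v] in an arbitrary subset of the
   vertices without neighbour in [T], because [N v] is independent. *)
Lemma fibre_sum (v : V) (T : {set V}) (F : {set V} -> nat) :
  v \in M -> T \in I -> [disjoint T & v |: N v] ->
  \sum_(W in I | W :\: (v |: N v) == T) F W
  = F (v |: T) + \sum_(Y in powerset [set u in N v | [forall w in T, ~~ e u w]])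
                   F (T :|: Y).
Proof.
move=> vM; rewrite inE => /andP[TM iT] dT.
set X := [set u in N v | _].
have vN : v \notin N v by rewrite !inE e_irr andbF.
have vT : v \notin T by rewrite (disjointFl dT) // setU11.
have NT u : u \in N v -> u \notin T.
  by move=> uN; rewrite (disjointFl dT) // setU1r.
have Tv w : w \in T -> ~~ e v w.
  move=> wT; apply/negP => vw; have := NT w.
  by rewrite !inE vw (subsetP TM) // wT => /(_ isT).
have TD : T :\: (v |: N v) = T by apply/setDidPl.
(* A member of the fibre is determined by [T], by whether it contains [v], and by its trace on
   [N v]; if it contains [v], independence makes that trace empty. *)
have mem_fibre W : W \in I -> W :\: (v |: N v) = T ->
    W = if v \in W then v |: T else T :|: (W :&: N v).
  rewrite inE => /andP[/subsetP WM /indepP iW] WT.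
  have eqT x : (x \in T) = [&& x != v, x \notin N v & x \in W].
    by rewrite -WT in_setD in_setU1 negb_or andbA.
  case: ifP => vW; apply/setP => x.
    rewrite in_setU1 eqT; case: eqP => [->|_] //=.
    case: (boolP (x \in W)) => [xW|]; last by rewrite andbF.
    by rewrite andbT !inE WM //= iW.
  rewrite in_setU in_setI eqT; case: eqP => [->|_] /=; first by rewrite vW.
  by case: (x \in W); rewrite ?andbF //= !andbT; case: (x \in N v).
rewrite (bigID (fun W : {set V} => v \in W)) /=; congr (_ + _).
  rewrite (big_pred1 (v |: T)) // => W.
  apply/idP/eqP => [/andP[/andP[WI /eqP WT] vW]|->].
    by rewrite (mem_fibre W) // vW.
  rewrite setU11 andbT; apply/andP; split.
    rewrite inE subUset sub1set vM TM; apply/indepP => x y.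
    rewrite !in_setU1 => /orP[/eqP->|xT] /orP[/eqP->|yT].
    - by rewrite e_irr.
    - exact: Tv.
    - by rewrite e_sym Tv.
    - by move/indepP: iT; apply.
  rewrite setDUl TD; apply/eqP/setP => x; rewrite !in_setU in_setD in_set1 in_setU1.
  by case: (x == v); rewrite ?andbF.
have UX (Y : {set V}) : Y \subset X -> (T :|: Y) :&: N v = Y.
  move=> YX; apply/setP => u; rewrite in_setI in_setU.
  case: (boolP (u \in Y)) => [/(subsetP YX)|_].
    by rewrite orbT /= in_set => /andP[].
  by rewrite orbF; apply/negP => /andP[uT /NT /negP].
rewrite (reindex_onto (fun Y => T :|: Y) (fun W => W :&: N v)) /=; last first.
  move=> W /andP[/andP[WI /eqP WT] vW].
  by rewrite [RHS](mem_fibre W) // (negbTE vW).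
apply: eq_bigl => Y; rewrite powersetE; apply/idP/idP; last first.
  move=> YX; rewrite (UX _ YX) eqxx andbT.
  have YN : Y \subset N v.
    by apply: subset_trans YX _; apply/subsetP => u; rewrite in_set => /andP[].
  rewrite in_setU (negbTE vT) /= (contra (subsetP YN v)) // andbT.
  apply/andP; split.
    rewrite inE subUset TM (subset_trans YN) ?subsetIl //=.
    apply/indepP => x y; rewrite !in_setU => /orP[xT|xY] /orP[yT|yY].
    - by move/indepP: iT; apply.
    - have := subsetP YX _ yY; rewrite in_set => /andP[_ /forall_inP /(_ _ xT)].
      by rewrite e_sym.
    - by have := subsetP YX _ xY; rewrite in_set => /andP[_ /forall_inP /(_ _ yT)].
    - by move/indepP: (indep_nbhd vM); apply; apply: (subsetP YN).
  rewrite setDUl TD; apply/eqP/setUidPl; apply/subsetP => x.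
  by rewrite in_setD in_setU1 negb_or => /andP[/andP[_ /negP xN] /(subsetP YN)].
move=> /andP[/andP[/andP[]]]; rewrite inE => /andP[_ /indepP iTY] _ _ /eqP YE.
apply/subsetP => u uY; have : u \in N v by move: uY; rewrite -YE in_setI => /andP[].
move=> uN; rewrite in_set uN /=; apply/forall_inP => w wT.
by apply: iTY; rewrite in_setU ?uY ?wT ?orbT.
Qed.

(** The independent sets are grouped by their part [T] outside the closed neighbourhood of [v]. In
    each group the claim reduces to [log_le_fibre_average], with [x] the number of neighbours of [v]
    that [T] leaves available. *)
Lemma vertex_average (v : V) : v \in M ->
  L * #|I| <= \sum_(W in I) 4 * (a * (v \in W) + #|W :&: N v|).
Proof.
move=> vM.
rewrite -sum1_card big_distrr /=.
have part (F : {set V} -> nat) : \sum_(W in I) F W =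
    \sum_(T in [set T in I | [disjoint T & v |: N v]])
      \sum_(W in I | W :\: (v |: N v) == T) F W.
  apply: partition_big => W WI; rewrite in_set; apply/andP; split; last first.
    by rewrite disjoint_sym disjoints_subset; apply/subsetP => x; rewrite in_setC in_setD => ->.
  move: WI; rewrite !inE => /andP[WM iW].
  by rewrite (indepS _ iW) ?subsetDl // (subset_trans (subsetDl _ _)).
rewrite (part (fun=> L * 1)) part; apply: leq_sum => T; rewrite in_set => /andP[TI dT].
rewrite !fibre_sum // sum_nat_const card_powerset.
set X := [set u in N v | _].
have UX (Y : {set V}) : Y \in powerset X -> #|(T :|: Y) :&: N v| >= #|Y|.
  rewrite powersetE => YX; apply: subset_leq_card; apply/subsetP => u uY.
  rewrite in_setI in_setU uY orbT /=.
  by have := subsetP YX _ uY; rewrite in_set => /andP[].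
have lo : 4 * \sum_(Y in powerset X) #|Y| <=
    \sum_(Y in powerset X) 4 * (a * (v \in T :|: Y) + #|(T :|: Y) :&: N v|).
  rewrite big_distrr /=; apply: leq_sum => Y YX.
  by rewrite leq_mul2l /=; apply: leq_trans (UX _ YX) (leq_addl _ _).
apply: leq_trans (leq_add (leqnn _) lo).
rewrite setU11 muln1.
have := log_le_fibre_average #|X| La; rewrite -sum_card_powerset; lia.
Qed.

(* Averages [a * (v \in W) + #|W :&: N v|] over uniformly random independent
   sets [W] and sums over [v \in M]. *)
Lemma card_triangle_free : #|M| * L <= 8 * (a * a).
Proof.
have I0 : 0 < #|I|.
  by apply/card_gt0P; exists set0; rewrite inE sub0set; apply/indepP => x; rewrite in_set0.
have degN v : v \in M -> #|N v| <= a.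
  by move=> vM; apply: alpha_le (indep_nbhd vM); apply: subsetIl.
(* Neighbourhoods are independent, so degrees inside [M] are at most [a]. Double counting bounds
   each of the two sums over [v] by [#|W| * a <= a * a], whence [8 = 4 * 2]. *)
have up W : W \in I -> \sum_(v in M) 4 * (a * (v \in W) + #|W :&: N v|) <= 8 * (a * a).
  rewrite inE => /andP[WM iW]; rewrite -big_distrr big_split -big_distrr /=.
  have -> : \sum_(v in M) (v \in W) = #|W|.
    rewrite -sum1_card big_mkcond [RHS]big_mkcond; apply: eq_bigr => v _.
    by case: (boolP (v \in W)) => [/(subsetP WM)->|_] //; rewrite if_same.
  have Wa : #|W| <= a by apply: alpha_le.
  have -> : \sum_(v in M) #|W :&: N v| = \sum_(w in W) #|N w|.
    under eq_bigr do rewrite -sum1dep_card.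
    rewrite (exchange_big_dep (mem W)) /= => [|v w _ /andP[]//].
    apply: eq_bigr => w wW; rewrite -sum1_card; apply: eq_bigl => v.
    by rewrite !inE wW (subsetP WM _ wW) e_sym.
  have : \sum_(w in W) #|N w| <= #|W| * a.
    rewrite -sum_nat_const; apply: leq_sum => w wW; apply: degN; exact: (subsetP WM).
  have : #|W| * a <= a * a by rewrite leq_mul2r Wa orbT.
  lia.
rewrite -(leq_pmul2r I0) -mulnA -sum_nat_const.
apply: (@leq_trans (\sum_(v in M) \sum_(W in I) 4 * (a * (v \in W) + #|W :&: N v|))).
  exact: leq_sum vertex_average.
rewrite exchange_big /= mulnC -sum_nat_const; exact: leq_sum.
Qed.
End TriangleFree.

(* Averages over [t] uniformly random vertices: deleting from their common
   neighbourhood one vertex of each bad pair leaves a set without bad pair. *)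
Lemma dependent_random_choice (t a : nat) (bad : rel V) :
  (forall U : {set V}, {in U &, forall u v, ~~ bad u v} -> #|U| <= a) ->
  \sum_v #|nbhd v| ^ t <=
    #|V| ^ t * a + \sum_(p : V * V | bad p.1 p.2) #|nbhd p.1 :&: nbhd p.2| ^ t.
Proof.
move=> small.
pose C (T : {ffun 'I_t -> V}) := [set v | [forall i, e v (T i)]].
(* Samples are drawn with repetition, so those lying entirely in [A] number [#|A| ^ t]. For [A] a
   neighbourhood or a common neighbourhood this turns the powers of the statement into counts of
   samples. *)
have countC (A : {set V}) :
    \sum_(T : {ffun 'I_t -> V}) (T \in ffun_on (mem A) : nat) = #|A| ^ t.
  transitivity #|ffun_on (mem A) : pred {ffun 'I_t -> V}|.
    by rewrite -sum1_card [RHS]big_mkcond; apply: eq_bigr => T _; case: (T \in _).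
  by rewrite card_ffun_on card_ord.
have memC v T : (v \in C T) = (T \in ffun_on (mem (nbhd v))).
  by rewrite inE; apply/forallP/ffun_onP => h i; move: (h i); rewrite inE.
have memC2 u v T : (u \in C T) && (v \in C T) = (T \in ffun_on (mem (nbhd u :&: nbhd v))).
  rewrite !memC; apply/andP/ffun_onP => [[/ffun_onP h /ffun_onP h'] i|h].
    by move: (h i) (h' i); rewrite !inE => -> ->.
  by split; apply/ffun_onP => i; move: (h i); rewrite !inE => /andP[].
(* Pairs are ordered and may repeat a vertex: a vertex that is bad with itself is deleted as
   well. *)
have bound T : #|C T| <= a + \sum_(p : V * V | bad p.1 p.2) ((p.1 \in C T) && (p.2 \in C T)).
  pose B := [set p : V * V | [&& bad p.1 p.2, p.1 \in C T & p.2 \in C T]].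
  have -> : \sum_(p : V * V | bad p.1 p.2) ((p.1 \in C T) && (p.2 \in C T)) = #|B|.
    rewrite -sum1_card big_mkcond [RHS]big_mkcond; apply: eq_bigr => p _.
    by rewrite [p \in B]in_set; case: (bad _ _) => //=; case: (_ && _).
  have U_small : #|C T :\: (fst @: B)| <= a.
    apply: small => u v; rewrite !in_setD => /andP[uB uC] /andP[_ vC].
    apply: contra uB => uv; apply/imsetP; exists (u, v) => //.
    by rewrite [_ \in B]in_set uv uC vC.
  rewrite -(cardsID (fst @: B)) addnC; apply: leq_add U_small _.
  by apply: leq_trans (leq_imset_card fst B); apply: subset_leq_card; apply: subsetIr.
have -> : \sum_v #|nbhd v| ^ t = \sum_(T : {ffun 'I_t -> V}) #|C T|.
  under eq_bigr do rewrite -countC.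
  rewrite exchange_big; apply: eq_bigr => T _ /=.
  rewrite -sum1_card [RHS]big_mkcond; apply: eq_bigr => v _.
  by rewrite -memC; case: (v \in C T).
have -> : \sum_(p : V * V | bad p.1 p.2) #|nbhd p.1 :&: nbhd p.2| ^ t =
    \sum_(T : {ffun 'I_t -> V}) \sum_(p : V * V | bad p.1 p.2) ((p.1 \in C T) && (p.2 \in C T)).
  rewrite exchange_big /=; apply: eq_bigr => p _; rewrite -countC.
  by apply: eq_bigr => T _; rewrite memC2.
have -> : #|V| ^ t * a = \sum_(T : {ffun 'I_t -> V}) a.
  by rewrite sum_nat_const card_ffun card_ord.
by rewrite -big_split /=; apply: leq_sum => T _.
Qed.

End Relation.

(** * Edge counting and copies of complete graphs *)

Section Graph.
Variables (V : finType) (G : sgraph V).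

Lemma adj_sym : symmetric (adj G).
Proof. by move=> x y; rewrite /adj setUC. Qed.

Lemma adj_irr : irreflexive (adj G).
Proof.
move=> x; rewrite /adj setUid; apply/negP => /(subsetP (edges_card2 G)).
by rewrite inE cards1.
Qed.

(** Every edge at [v] is [[set v; x]] for a neighbour [x], so [v] lies in at most as many edges as
    it has neighbours. *)
Lemma edges_handshake : 2 * #|edges G| <= \sum_v #|nbhd (adj G) v|.
Proof.
have -> : 2 * #|edges G| = \sum_(E in edges G) \sum_(v in E) 1.
  rewrite mulnC -sum_nat_const; apply: eq_bigr => E EG.
  by have := subsetP (edges_card2 G) _ EG; rewrite inE sum1_card => /eqP.
rewrite (exchange_big_dep predT) //=; apply: leq_sum => v _.
rewrite sum1dep_card.
apply: leq_trans (leq_imset_card (fun x => [set v; x]) _).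
apply: subset_leq_card; apply/subsetP => E; rewrite inE => /andP[EG vE].
have := subsetP (edges_card2 G) _ EG; rewrite inE => /cards2P[x [y [_ Exy]]].
apply/imsetP; move: vE EG; rewrite Exy !inE => /orP[]/eqP-> EG.
  by exists y; rewrite // inE.
by exists x; rewrite ?inE /adj setUC.
Qed.

Lemma clique_contains_copy (r : nat) (S : {set V}) :
  clique (adj G) S -> #|S| = r -> contains_copy (complete_graph 'I_r) G.
Proof.
move=> /cliqueP cS Sr.
apply/existsP; exists [ffun i : 'I_r => enum_val (cast_ord (esym Sr) i)].
have inj : injective (fun i : 'I_r => enum_val (cast_ord (esym Sr) i)).
  by move=> i j /enum_val_inj /cast_ord_inj.
apply/andP; split; first by apply/injectiveP => i j; rewrite !ffunE => /inj.
apply/forallP => i; apply/forallP => j; apply/implyP; rewrite /adj inE cards2 !ffunE.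
have [//|ij _] := eqVneq i j; rewrite -/(adj G _ _); apply: cS; rewrite ?enum_valP //.
by rewrite (inj_eq inj).
Qed.

Lemma indep_le_independence_number (S : {set V}) :
  indep (adj G) S -> #|S| <= independence_number G.
Proof. exact: leq_bigmax_cond. Qed.

End Graph.

Lemma copy_free_clique (V : finType) (G : sgraph V) (r : nat) (S : {set V}) :
  free_of (complete_graph 'I_r) G -> clique (adj G) S -> #|S| != r.
Proof.
move=> /negP free cS; apply/eqP => Sr; apply: free; exact: clique_contains_copy Sr.
Qed.

(** * Ramsey and codegree bounds for [K_5]-free graphs *)

Section K5Free.
Variables (V : finType) (G : sgraph V).
Hypothesis free : free_of (complete_graph 'I_5) G.
Let a := independence_number G.
Let e_sym := @adj_sym V G.
Let e_irr := @adj_irr V G.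

Lemma independence_number_gt0 : 0 < #|V| -> 0 < a.
Proof.
move=> /card_gt0P[x _]; rewrite -(cards1 x); apply: indep_le_independence_number.
by apply/indepP => ? ? /set1P-> /set1P->; rewrite e_irr.
Qed.

(** The Ramsey-type bound [card_clique_free] with [r = 4]; it later bounds [log n] by a multiple of
    the logarithm of [a]. *)
Lemma K5_free_card_le : #|V| <= 4 * a ^ 4.
Proof.
have [->//|V0] := posnP #|V|.
rewrite -cardsT; apply: (card_clique_free e_sym e_irr).
- exact: independence_number_gt0.
- by move=> S _; apply: copy_free_clique.
- by move=> S _; apply: indep_le_independence_number.
Qed.

(** A triangle in the common neighbourhood would extend by [u] and [v] to a clique on 5 vertices, so
    the triangle-free bound applies there. *)
Lemma K5_free_codegree_le (u v : V) : adj G u v -> 0 < a ->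
  #|nbhd (adj G) u :&: nbhd (adj G) v| * trunc_log 2 a <= 8 * (a * a).
Proof.
move=> uv a0; apply: (card_triangle_free e_sym e_irr); last exact: trunc_logP.
  move=> S; rewrite subsetI => /andP[Su Sv] cS; apply/eqP => S3.
  have uvS : v |: S \subset nbhd (adj G) u by rewrite subUset sub1set inE uv Su.
  have := copy_free_clique free (clique1U e_sym uvS (clique1U e_sym Sv cS)).
  by rewrite cardsU1 (nbhd_notin e_irr uvS) cardsU1 (nbhd_notin e_irr Sv) S3.
by move=> S _; apply: indep_le_independence_number.
Qed.

End K5Free.

Local Open Scope ring_scope.

(** * Power sums and the number of samples *)

(** A substitute for convexity. Values below [d] add up to at most [#|V| * d], so the others add up
    to more than that; as each is at most [#|V|], there are at least [d] of them, each contributing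
    at least [d ^+ t]. *)
Lemma sum_exp_ge (R : realFieldType) (V : finType) (f : V -> nat) (d : R) (t : nat) :
  (forall v, f v <= #|V|)%N -> 0 <= d ->
  2 * (#|V|%:R * d) < (\sum_v f v)%:R -> d ^+ t.+1 <= (\sum_v f v ^ t)%:R.
Proof.
move=> f_le d0 lt_sum; set H := [set v | d <= (f v)%:R].
have sum_le : (\sum_v f v)%:R <= #|H|%:R * #|V|%:R + #|V|%:R * d.
  rewrite natr_sum (bigID (mem H)) /=; apply: lerD.
    rewrite -natrM -sum_nat_const natr_sum; apply: ler_sum => v _.
    by rewrite ler_nat.
  apply: (@le_trans _ _ (\sum_(v | v \notin H) d)).
    by apply: ler_sum => v; rewrite inE -ltNge => /ltW.
  rewrite sumr_const -[leLHS]mulr_natl ler_wpM2r // ler_nat.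
  exact: max_card.
have dH : d <= #|H|%:R.
  have [V0|V0] := posnP #|V|.
    move: lt_sum; rewrite big1 ?V0 ?mul0r ?mulr0 ?ltxx // => v _.
    by move: (f_le v); rewrite V0 leqn0 => /eqP.
  have V0' : 0 < #|V|%:R :> R by rewrite ltr0n.
  rewrite -(ler_pM2r V0'); nra.
rewrite exprS natr_sum (bigID (mem H)) /=.
apply: (@le_trans _ _ (\sum_(v in H) d ^+ t)).
  by rewrite sumr_const -[leRHS]mulr_natl ler_wpM2r // exprn_ge0.
apply: (@le_trans _ _ (\sum_(v in H) (f v ^ t)%:R)).
  by apply: ler_sum => v; rewrite inE natrX => dv; rewrite lerXn2r // nnegrE.
by rewrite lerDl sumr_ge0.
Qed.

(** The least [t] reaching [x] works: its predecessor fails, and one step multiplies by [y ^+ 3].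
    The case [t = 0] is excluded by [1 < x]. *)
Lemma ex_sampling_size (R : archiRealFieldType) (y x : R) : 2 <= y -> 1 < x ->
  exists t, x <= y ^+ (3 * t) /\ y ^+ (3 * t) < x * y ^+ 3.
Proof.
move=> y2 x1.
have ex : exists t, x <= y ^+ (3 * t).
  exists (Num.bound x); apply/ltW.
  apply: (@lt_le_trans _ _ (2 ^+ (Num.bound x))); first exact: upper_nthrootP.
  apply: (@le_trans _ _ (y ^+ (Num.bound x))); first by rewrite lerXn2r // nnegrE; lra.
  by rewrite ler_weXn2l //; [lra|lia].
exists (ex_minn ex); case: ex_minnP => t xt tmin; split=> //.
case: t xt tmin => [|t] xt tmin; first by move: xt; rewrite muln0 expr0 leNgt x1.
rewrite mulnS addnC exprD ltr_pM2r; last by rewrite exprn_gt0 //; lra.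
by rewrite ltNge; apply/negP => /tmin; rewrite ltnn.
Qed.

(** * The edge bound for a single graph *)

Lemma edges_le (R : realType) (n : nat) (G : sgraph 'I_n) (y : R) :
  free_of (complete_graph 'I_5) G -> 3 <= y -> (5 <= n)%N ->
  256 * log2 n%:R ^+ 3 <= n%:R :> R ->
  (independence_number G)%:R < Num.sqrt (n%:R * log2 n%:R) / y ^+ 4 ->
  #|edges G|%:R <= n%:R ^+ 2 / y.
Proof.
move=> free y3 n5; set l := log2 n%:R; set a := independence_number G.
set S := Num.sqrt _ => ln_le aS; rewrite leNgt; apply/negP => many.
have y0 : 0 < y by lra.
have yn0 k : 0 < y ^+ k by exact: exprn_gt0.
set N : R := n%:R; have N5 : 5 <= N by rewrite /N ler_nat.
have N0 : 0 < N by lra.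
have l2 : 0 < ln (2 : R) by rewrite ln_gt0 // ltr1n.
have l0 : 0 <= l by rewrite divr_ge0 ?ln_ge0 ?(ltW l2) // -/N; lra.
have S0 : 0 <= S by exact: sqrtr_ge0.
have S2 : S ^+ 2 = N * l by rewrite sqr_sqrtr // mulr_ge0 // ltW.
have card_le : (n <= 4 * a ^ 4)%N by have := K5_free_card_le free; rewrite card_ord.
have [a2 n2] := le_exp_trunc_log n5 card_le.
have a0 : (0 < a)%N by exact: ltnW.
set L := trunc_log 2 a.
have L1 : (1 <= L)%N by rewrite trunc_log_gt0.
have lL : l <= 10 * L%:R.
  rewrite /l /log2 ler_pdivrMr // -natrM mulrC mulr_natr -lnXn // -natrX.
  by rewrite ler_ln ?posrE ?ltr0n ?expn_gt0 // ?ler_nat // (leq_trans _ n5).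
pose e := adj G; pose m := N / y ^+ 4.
pose codeg u v := #|nbhd e u :&: nbhd e v|.
(* An edge inside [U] would have codegree at least [m]; with [a < S / y ^+ 4] the codegree bound
   then gives [y ^+ 4 * L <= 8 * l <= 80 * L]. *)
have small (U : {set 'I_n}) :
    {in U &, forall u v, ~~ ((codeg u v)%:R < m)} -> (#|U| <= a)%N.
  move=> Ugood; apply: indep_le_independence_number; apply/indepP => u v uU vU.
  apply/negP => uv; have := Ugood u v uU vU; rewrite -leNgt => m_le.
  have := K5_free_codegree_le free uv a0; rewrite -/(codeg u v) -/a -/L.
  rewrite -(ler_nat R) !natrM => cL.
  have aa : a%:R * a%:R <= N * l / (y ^+ 4 * y ^+ 4).
    rewrite -S2 expr2 invfM mulrACA ler_pM // ltW //.
  have Lr : 1 <= L%:R :> R by rewrite ler1n.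
  have : N / y ^+ 4 * L%:R <= 8 * (N * l / (y ^+ 4 * y ^+ 4)).
    apply: (@le_trans _ _ ((codeg u v)%:R * L%:R)); last first.
      by apply: le_trans cL _; rewrite ler_pM2l.
    by rewrite ler_wpM2r.
  (* The assumption [3 <= y] enters here: [3 ^+ 4] is just above [80 = 8 * 10]. *)
  have y81 : 81 <= y ^+ 4.
    by apply: (@le_trans _ _ (3 ^+ 4)); [lra | rewrite lerXn2r // nnegrE; lra].
  set z := y ^+ 4 in y81 *.
  have -> : N / z * L%:R = N / (z * z) * (z * L%:R) by field; lra.
  have -> : 8 * (N * l / (z * z)) = N / (z * z) * (8 * l) by field; lra.
  rewrite ler_pM2l; last by rewrite divr_gt0 // mulr_gt0; lra.
  nra.
(* The lower bound on [t] makes the bad pairs cost at most half of the expected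
   [N / y ^+ t.+1] common neighbours; the upper bound keeps that half above
   [S / y ^+ 4]. *)
have [t [t_ge t_lt]] : exists t,
    2 * N * y <= y ^+ (3 * t) /\ y ^+ (3 * t) < 2 * N * y * y ^+ 3.
  by apply: ex_sampling_size; nra.
have := dependent_random_choice e t small; rewrite card_ord => drc.
have deg_sum : (N / y) ^+ t.+1 <= (\sum_v #|nbhd e v| ^ t)%:R.
  apply: sum_exp_ge => [v||]; first exact: max_card.
    by rewrite divr_ge0 // ltW.
  have := edges_handshake G; rewrite -(ler_nat R) natrM => /(lt_le_trans _); apply.
  by rewrite card_ord ltr_pM2l // -/N mulrA -expr2.
have bad_sum : N ^+ 2 * m ^+ t >=
    (\sum_(p : 'I_n * 'I_n | ((codeg p.1 p.2)%:R < m)%R) codeg p.1 p.2 ^ t)%:R.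
  rewrite natr_sum; apply: (@le_trans _ _ (\sum_(p : 'I_n * 'I_n) m ^+ t)).
    rewrite [leLHS]big_mkcond; apply: ler_sum => p _.
    case: ifP => [lt_m|_]; last by rewrite exprn_ge0 // divr_ge0 ?ltW.
    by rewrite natrX lerXn2r ?nnegrE ?(ltW lt_m) // divr_ge0 // ltW.
  by rewrite sumr_const card_prod card_ord -[leLHS]mulr_natl natrM expr2.
have main : (N / y) ^+ t.+1 <= N ^+ t * a%:R + N ^+ 2 * m ^+ t.
  apply: le_trans deg_sum _; move: drc; rewrite -(ler_nat R) natrD => /le_trans; apply.
  by rewrite natrM natrX lerD2l.
set w := y ^+ t; have w0 : 0 < w by exact: yn0.
have w3 : y ^+ (3 * t) = w ^+ 3 by rewrite mulnC exprM.
rewrite w3 in t_ge t_lt.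
(* This is [main] divided by [N ^+ t], with [w = y ^+ t]. *)
have : N / (y * w) <= a%:R + N ^+ 2 / w ^+ 4.
  have Nt : 0 < N ^+ t by exact: exprn_gt0.
  rewrite -(ler_pM2l Nt); apply: le_trans (le_trans main _).
    rewrite expr_div_n !exprS -/w le_eqVlt; apply/orP; left; apply/eqP.
    by field; lra.
  rewrite /m expr_div_n -exprM mulnC exprM -/w mulrDr lerD2l le_eqVlt; apply/orP; left; apply/eqP.
  by field; lra.
have : N ^+ 2 / w ^+ 4 <= N / (y * w) / 2.
  have -> : N ^+ 2 / w ^+ 4 = N / (w ^+ 4 * y * 2) * (2 * N * y) by field; lra.
  have -> : N / (y * w) / 2 = N / (w ^+ 4 * y * 2) * w ^+ 3 by field; lra.
  rewrite ler_pM2l // divr_gt0 // !mulr_gt0 //; exact: exprn_gt0.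
move=> h1 h2.
have h3 : N / (y * w) / 2 < S / y ^+ 4 by lra.
have h4 : N * y ^+ 3 < 2 * S * w.
  have c0 : 0 < 2 * w * y ^+ 4 by rewrite !mulr_gt0.
  move: h3; rewrite -(ltr_pM2l c0).
  have -> : 2 * w * y ^+ 4 * (N / (y * w) / 2) = N * y ^+ 3 by field; lra.
  by have -> : 2 * w * y ^+ 4 * (S / y ^+ 4) = 2 * S * w by field; lra.
(* Sixth powers remove the square root through [S ^+ 2 = N * l] and turn [w] into powers of
   [w ^+ 3], which the choice of [t] bounds. The outcome is [(N * y ^+ 3) ^+ 6 < 256 * N ^+ 5 * l ^+
   3 * y ^+ 8 <= N ^+ 6 * y ^+ 8], impossible for [y >= 3]. *)
have h5 : (N * y ^+ 3) ^+ 6 < (2 * S * w) ^+ 6.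
  by rewrite ltrXn2r // mulr_ge0 // ltW.
have h6 : (2 * S * w) ^+ 6 = 64 * (N * l) ^+ 3 * (w ^+ 3) ^+ 2 by rewrite -S2; ring.
have h7 : (w ^+ 3) ^+ 2 <= (2 * N * y * y ^+ 3) ^+ 2.
  by rewrite lerXn2r ?nnegrE ?ltW // ?exprn_gt0 // !mulr_gt0.
have h8 : 64 * (N * l) ^+ 3 * (2 * N * y * y ^+ 3) ^+ 2 <= N ^+ 6 * y ^+ 8.
  have -> : 64 * (N * l) ^+ 3 * (2 * N * y * y ^+ 3) ^+ 2
          = (N ^+ 5 * y ^+ 8) * (256 * l ^+ 3) by ring.
  have -> : N ^+ 6 * y ^+ 8 = (N ^+ 5 * y ^+ 8) * N by ring.
  by rewrite ler_pM2l // mulr_gt0 // exprn_gt0.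
have h9 : N ^+ 6 * y ^+ 8 <= (N * y ^+ 3) ^+ 6.
  rewrite exprMn -exprM ler_pM2l ?exprn_gt0 // ler_weXn2l //; lra.
have h10 : 64 * (N * l) ^+ 3 * (w ^+ 3) ^+ 2 <= 64 * (N * l) ^+ 3 * (2 * N * y * y ^+ 3) ^+ 2.
  by rewrite ler_wpM2l // mulr_ge0 // exprn_ge0 // mulr_ge0 // ltW.
lra.
Qed.

(** * Growth of the logarithm *)

(** With [r] the sixth root of [n], [ln n = 6 * ln r <= 6 * r], so the left side is at most
    [D * r ^+ 3], and [D <= r ^+ 3] once [n >= D ^+ 2]. *)
Lemma near_log2_cube_le (R : realType) (C : R) :
  \forall n \near \oo%classic, C * log2 n%:R ^+ 3 <= n%:R.
Proof.
have l2 : 0 < ln (2 : R) by rewrite ln_gt0 // ltr1n.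
set D : R := `|C| * (6 / ln 2) ^+ 3.
near=> n.
have n1 : 1 <= n%:R :> R by near: n; exact: nbhs_infty_ger.
have nD : D ^+ 2 <= n%:R by near: n; exact: nbhs_infty_ger.
set r := n%:R `^ (1 / 6) : R.
have r0 : 0 < r by rewrite powR_gt0; lra.
have r6 : r ^+ 6 = n%:R.
  by rewrite -powR_mulrn ?ltW // -powRrM div1r mulVf ?pnatr_eq0 // powRr1 //; lra.
have D0 : 0 <= D by rewrite mulr_ge0 // exprn_ge0 // divr_ge0 // ltW.
have Dr : D <= r ^+ 3.
  by rewrite -(@ler_pXn2r _ 2) ?nnegrE ?exprn_ge0 ?(ltW r0) // -exprM r6.
have ll : 0 <= log2 (n%:R : R) <= 6 / ln 2 * r.
  apply/andP; split; first by apply: divr_ge0; [exact: ln_ge0|exact: ltW].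
  rewrite /log2 mulrAC ler_pM2r ?invr_gt0 //.
  rewrite -r6 lnXn // -[leLHS]mulr_natl ler_pM2l //; exact/ltW/ln_sublinear.
apply: (@le_trans _ _ (`|C| * (6 / ln 2 * r) ^+ 3)).
  apply: le_trans (_ : `|C| * log2 n%:R ^+ 3 <= _).
    by rewrite ler_wpM2r ?ler_norm // exprn_ge0 //; case/andP: ll.
  case/andP: ll => ll0 ll1; rewrite ler_wpM2l // lerXn2r // nnegrE; lra.
by rewrite exprMn mulrA -/D -r6 -[6%N]/(3 + 3)%N exprD ler_wpM2r // exprn_ge0 // ltW.
Unshelve. all: end_near. Qed.

(** * Passage to the asymptotic statements *)

Import numFieldNormedType.Exports.

Local Open Scope classical_set_scope.
Local Open Scope ring_scope.

Theorem theorem3p2 (R : realType) (omega : nat -> R)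
    (homega : omega @ \oo --> +oo) :
  (\forall n \near \oo,
     (RT n (complete_graph 'I_5)
        (Num.sqrt (n%:R * log2 n%:R) / omega n))%:R
     <= n%:R ^+ 2 / omega n `^ (1 / 4))
  /\
  ((fun n : nat =>
      (RT n (complete_graph 'I_5)
        (Num.sqrt (n%:R * log2 n%:R) / omega n))%:R : R^o)
   =o_\oo (fun n : nat => n%:R ^+ 2 : R^o)).
Proof.
have omega_ge (A : R) : \forall n \near \oo, A <= omega n by move/cvgryPge: homega; apply.
have root4 (x : R) : 0 <= x -> (x `^ (1 / 4)) ^+ 4 = x.
  by move=> x0; rewrite -powR_mulrn ?powR_ge0 // -powRrM div1r mulVf ?pnatr_eq0 // powRr1.
have root4_ge (c x : R) : 0 <= c -> c ^+ 4 <= x -> c <= x `^ (1 / 4).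
  move=> c0 cx; rewrite -(@ler_pXn2r _ 4) ?nnegrE ?powR_ge0 // root4 //.
  by apply: le_trans cx; exact: exprn_ge0.
have bound : \forall n \near \oo,
     (RT n (complete_graph 'I_5) (Num.sqrt (n%:R * log2 n%:R) / omega n))%:R
     <= n%:R ^+ 2 / omega n `^ (1 / 4).
  near=> n.
  have w : 3 ^+ 4 <= omega n by near: n; exact: omega_ge.
  have y3 : 3 <= omega n `^ (1 / 4) by apply: root4_ge w.
  have n5 : (5 <= n)%N by near: n; exact: nbhs_infty_ge.
  have ln_le : 256 * log2 n%:R ^+ 3 <= n%:R :> R by near: n; exact: near_log2_cube_le.
  (* [RT] is a maximum with default 0: nonnegativity of the right side covers the default, and
     [edges_le] each admissible graph. *)
  rewrite /RT; elim/big_ind: _ => [|i j hi hj|G /andP[free aG]].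
  - by rewrite divr_ge0 ?powR_ge0 // exprn_ge0.
  - by rewrite /maxn; case: ifP.
  - apply: edges_le => //; rewrite root4 //; apply: le_trans w; exact: exprn_ge0.
split=> //; apply/eqoP => eps eps0; near=> n.
(* The fourth power is chosen so that the reciprocal of the fourth root of [omega n] is at most
   [eps]. *)
have w : eps^-1 ^+ 4 <= omega n by near: n; exact: omega_ge.
have y_ge : eps^-1 <= omega n `^ (1 / 4) by apply: root4_ge; rewrite ?invr_ge0 // ltW.
rewrite !ger0_norm ?exprn_ge0 //.
apply: (@le_trans _ _ (n%:R ^+ 2 / omega n `^ (1 / 4))); first by near: n; exact: bound.
rewrite [leRHS]mulrC ler_wpM2l ?exprn_ge0 // -[leRHS]invrK lef_pV2 ?posrE ?invr_gt0 //.
by apply: lt_le_trans y_ge; rewrite invr_gt0.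
Unshelve. all: end_near. Qed.
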